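(* Let $F$ be a field of characteristic zero and let $W$ be the four-dimensional $F$-algebra with basis $\{e_{-1},e_0,e_1,e_2\}$ and the multiplication given in the context. Then the PI-exponent $\exp(W)=\lim_{n\to\infty}\sqrt[n]{c_n(W)}$ exists and $$\exp(W)=\max\{\Phi(x_1,x_2,x_3,x_4)\mid (x_1,x_2,x_3,x_4)\in T\},$$ where $$\Phi(x_1,\ldots,x_4)=\frac{1}{x_1^{x_1}x_2^{x_2}x_3^{x_3}x_4^{x_4}}\qquad(0\le x_1,\ldots,x_4\le 1,\ 0^0=1)$$ and $T$ is the set of all $(x_1,\ldots,x_4)\in[0,1]^4$ such that $x_1\ge x_2\ge x_3\ge x_4$, $x_1+x_2+x_3+x_4=1$ and $x_1-x_3=2x_4$. In particular, $\exp(W)\approx 3.610718614$.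
   Context: Algebras are not assumed associative. The algebra $W$ over $F$ has basis $\{e_{-1},e_0,e_1,e_2\}$ and multiplication: (a) $e_ie_0=e_0e_i=e_i$ for all $-1\le i\le 2$; (b) for $i,j\ne 0$, $e_ie_j=0$ if $i>j$ or $i+j<-1$ or $i+j>2$; (c) $e_ie_j=e_{i+j}$ in all remaining cases. (So the only nonzero products $e_ie_j$ with $i,j\neq 0$ are $e_{-1}e_1=e_0$, $e_{-1}e_2=e_1$, $e_1e_1=e_2$.) Codimensions: $F\{X\}$ is the free nonassociative $F$-algebra on a countable set $X=\{x_1,x_2,\ldots\}$; a polynomial $f(x_1,\ldots,x_n)\in F\{X\}$ is an identity of an algebra $A$ if $f(a_1,\ldots,a_n)=0$ for all $a_1,\ldots,a_n\in A$; $Id(A)$ is the ideal of all identities of $A$; $P_n\subset F\{X\}$ is the subspace of all polynomials multilinear in $x_1,\ldots,x_n$; and $c_n(A)=\dim_F \frac{P_n}{P_n\cap Id(A)}$. *)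

(* Defs.v *)
From HB Require Import structures.
From mathcomp Require Import all_boot all_order all_algebra.
From mathcomp Require Import all_classical all_reals all_analysis.
From mathcomp Require Import multinomials.freeg.

Set Implicit Arguments.
Unset Strict Implicit.
Unset Printing Implicit Defensive.

Import Order.TTheory GRing.Theory Num.Theory.
Import numFieldNormedType.Exports.

Local Open Scope classical_set_scope.
Local Open Scope ring_scope.

(* The free magma on X = {x_1, x_2, ...}: its elements are the nonassociative
   monomials.  [Var k] stands for x_{k+1}. *)
Inductive word := Var of nat | Mul of word & word.

Fixpoint tree_of_word (w : word) : GenTree.tree nat :=
  match w with
  | Var k => GenTree.Leaf k
  | Mul u v => GenTree.Node 0 [:: tree_of_word u; tree_of_word v]
  end.

Fixpoint word_of_tree (t : GenTree.tree nat) : option word :=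
  match t with
  | GenTree.Leaf k => Some (Var k)
  | GenTree.Node _ [:: u; v] =>
      if (word_of_tree u, word_of_tree v) is (Some u', Some v')
      then Some (Mul u' v') else None
  | GenTree.Node _ _ => None
  end.

Lemma tree_of_wordK : pcancel tree_of_word word_of_tree.
Proof. by elim=> //= u -> v ->. Qed.

HB.instance Definition _ := Countable.copy word (pcan_type tree_of_wordK).

Fixpoint letters (w : word) : seq nat :=
  match w with
  | Var k => [:: k]
  | Mul u v => letters u ++ letters v
  end.

Section Codimensions.

Variable F : fieldType.

(* F{X} is represented by its underlying vector space {freeg word / F}, with
   basis the free magma; its product is the bilinear extension of [Mul]. *)

(* P_n: in every monomial of the polynomial each of x_1, ..., x_n occurs
   exactly once, and no other variable occurs. *)
Definition multilinear (n : nat) : set {freeg word / F} :=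
  [set f | forall w, w \in dom f -> perm_eq (letters w) (iota 0 n)].

(* [b] represents a basis of the quotient space P / Q. *)
Definition quotient_basis (V : lmodType F) (P Q : set V) (d : nat)
    (b : 'I_d -> V) : Prop :=
  [/\ forall i, P (b i),
      forall f, P f -> exists c : 'I_d -> F, Q (f - \sum_(i < d) c i *: b i)
    & forall c : 'I_d -> F, Q (\sum_(i < d) c i *: b i) -> forall i, c i = 0].

(* dim (P / Q), for subspaces Q <= P with P / Q finite-dimensional. *)
Definition quotient_dim (V : lmodType F) (P Q : set V) : nat :=
  xget 0%N [set d | exists b : 'I_d -> V, quotient_basis P Q b].

(* A (not necessarily associative) F-algebra is an F-module [A] with a bilinear
   product [mul]. *)
Variables (A : lmodType F) (mul : {bilinear A -> A -> A}).

Fixpoint eval_word (a : nat -> A) (w : word) : A :=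
  match w with
  | Var k => a k
  | Mul u v => mul (eval_word a u) (eval_word a v)
  end.

(* f(a_1, a_2, ...): the value of f under the homomorphism F{X} -> A sending
   each variable to its assigned element. *)
Definition poly_eval (a : nat -> A) (f : {freeg word / F}) : A :=
  fglift (eval_word a) f.

Definition identities : set {freeg word / F} :=
  [set f | forall a : nat -> A, poly_eval a f = 0].

Definition codim (n : nat) : nat :=
  quotient_dim (multilinear n) (multilinear n `&` identities).

Definition codim_root (R : realType) (n : nat) : R :=
  (codim n)%:R `^ (n%:R^-1).

Definition PI_exponent (R : realType) : R := limn (codim_root R).

End Codimensions.

Section AlgebraW.

Variable F : fieldType.

(* The basis vector e_k, for -1 <= k <= 2. *)
Definition We (k : int) : 'rV[F]_4 := delta_mx 0 (inord (absz (k + 1))).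

(* The product e_i e_j. *)
Definition We_mul (i j : int) : 'rV[F]_4 :=
  if j == 0 then We i
  else if i == 0 then We j
  else if [|| j < i, i + j < -1 | 2 < i + j] then 0
  else We (i + j).

(* Column i of a row vector holds the coordinate along e_{i-1}. *)
Definition Wmul (u v : 'rV[F]_4) : 'rV[F]_4 :=
  \sum_(i < 4) \sum_(j < 4)
    (u 0 i * v 0 j) *: We_mul (i%:Z - 1) (j%:Z - 1).

Lemma Wmul_bilinear : bilinear_for *:%R *:%R Wmul.
Proof.
split=> [v c u1 u2 | u c v1 v2] /=; rewrite /Wmul scaler_sumr -big_split /=;
  apply: eq_bigr => i _; rewrite scaler_sumr -big_split /=;
  apply: eq_bigr => j _; rewrite !mxE scalerA -scalerDl.
  by rewrite mulrDl mulrA.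
by rewrite mulrDr mulrCA.
Qed.

HB.instance Definition _ :=
  bilinear_isBilinear.Build F 'rV[F]_4 'rV[F]_4 'rV[F]_4 *:%R *:%R Wmul
    Wmul_bilinear.

End AlgebraW.

(* Note that 0 `^ 0 = 1. *)
Definition Phi (R : realType) (x : 'rV[R]_4) : R :=
  (\prod_(i < 4) (x 0 i `^ x 0 i))^-1.

(* The coordinates x_1, x_2, x_3, x_4 are x 0 0, x 0 1, x 0 2, x 0 3. *)
Definition domT (R : realType) : set 'rV[R]_4 :=
  [set x | [/\ forall i, 0 <= x 0 i <= 1,
               [/\ x 0 0 >= x 0 1, x 0 1 >= x 0 2 & x 0 2 >= x 0 3],
               x 0 0 + x 0 1 + x 0 2 + x 0 3 = 1
             & x 0 0 - x 0 2 = 2 * x 0 3]].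

(* Main.v *)
(* Grade W by deg e_k = k.  A multilinear polynomial is determined modulo the
   identities by its values on basis tuples, and these vanish unless the sum of
   the degrees lies in [-1, 2]; so c_n(W) is at most the number of such tuples,
   which is O(Z^n) with Z = 1/u + 1 + u + u^2 for every u in (0, 1).
   Conversely, right multiplication of e_2 by a equals e_2 times the
   e_0-coordinate of a.  Put e_2 in place of one extra variable and multiply it
   on the right by z for each unit, by (x y) for each pair (e_{-1}, e_1) and by
   (x (x' t)) for each triple (e_{-1}, e_{-1}, e_2): this attaches to every
   degree-0 tuple of length n a monomial of degree n + 1, and the resulting
   evaluation matrix is triangular with respect to the number of units.  Hence
   c_{n+1}(W) is at least the number of degree-0 tuples, which is at least
   'C(n, j) 'C(n, 2j) for all j.  For the root u of 2u^3 + u^2 = 1 and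
   j ~ n u^2 / (1 + u^2) this grows like Z^n; and Z is the maximum of Phi, by
   Gibbs' inequality against the weights proportional to (1/u, 1, u, u^2). *)

Require Import Defs.
From HB Require Import structures.
From mathcomp Require Import all_boot all_order all_algebra.
From mathcomp Require Import all_classical all_reals all_analysis.
From mathcomp Require Import multinomials.freeg.
From mathcomp Require Import ring lra zify.

Set Implicit Arguments.
Unset Strict Implicit.
Unset Printing Implicit Defensive.

Import Order.TTheory GRing.Theory Num.Theory.
Import numFieldNormedType.Exports.

Local Open Scope classical_set_scope.
Local Open Scope ring_scope.

(** * Dimension of a quotient P / Q, where Q is the kernel on P of a linear map *)

Section QuotientDim.

Variables (F : fieldType) (V : lmodType F) (P Q : set V) (m : nat).
Variable phi : {linear V -> 'rV[F]_m}.
Hypothesis P_submod : forall (c : F) (u v : V), P u -> P v -> P (c *: u + v).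
Hypothesis P0 : P 0.
Hypothesis QE : forall f, P f -> (Q f <-> phi f = 0).

Let mx d (b : 'I_d -> V) : 'M[F]_(d, m) := \matrix_i phi (b i).

Lemma lincomb_closed d (b : 'I_d -> V) (c : 'I_d -> F) :
  (forall i, P (b i)) -> P (\sum_(i < d) c i *: b i).
Proof.
move=> Pb; apply: (big_ind P) => // [u v Pu Pv|i _].
  by rewrite -[u]scale1r; apply: P_submod.
by rewrite -[_ *: _]addr0; apply: P_submod.
Qed.

Lemma image_lincomb d (b : 'I_d -> V) (c : 'I_d -> F) :
  phi (\sum_(i < d) c i *: b i) = (\row_i c i) *m mx b.
Proof.
rewrite linear_sum mulmx_sum_row; apply: eq_bigr => i _.
by rewrite linearZ mxE rowK.
Qed.

Lemma row_free_image d (b : 'I_d -> V) : (forall i, P (b i)) ->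
  row_free (mx b) <->
  (forall c : 'I_d -> F, Q (\sum_(i < d) c i *: b i) -> forall i, c i = 0).
Proof.
move=> Pb; split=> [fr c /QE - /(_ (lincomb_closed _ Pb)) | free].
  rewrite image_lincomb => /eqP; rewrite mulmx_free_eq0 // => /eqP/rowP c0 i.
  by have := c0 i; rewrite !mxE.
apply: inj_row_free => v v0; apply/rowP => i; rewrite mxE.
apply: (free (fun i => v 0 i)); apply/QE; first exact: lincomb_closed.
by rewrite image_lincomb -[RHS]v0; congr mulmx; apply/rowP => j; rewrite mxE.
Qed.

(** The images of a basis of P / Q span the image of all of P, so comparing ranks bounds the length
    of any family with independent images. *)
Lemma quotient_basis_max d (b : 'I_d -> V) (n : nat) (v : 'I_n -> V) :
  quotient_basis P Q b -> (forall i, P (v i)) -> row_free (mx v) ->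
  (n <= d)%N.
Proof.
move=> [Pb span _] Pv /eqP <-; apply: leq_trans (rank_leq_row (mx b)).
apply: mxrankS; apply/row_subP => i; rewrite rowK.
have [c Qc] := span _ (Pv i).
have /QE[/(_ Qc)] : P (v i - \sum_(i < d) c i *: b i).
  by rewrite -scaleN1r addrC; apply: P_submod => //; apply: lincomb_closed.
rewrite linearB /= image_lincomb => /eqP.
by rewrite subr_eq0 => /eqP -> _; apply: submxMl.
Qed.

(** Take a family in P of maximal length with independent images, the length being at most [m]; an
    element of P with image outside their span could be adjoined to it. This ensures that the [xget]
    in [quotient_dim] returns an actual dimension. *)
Lemma quotient_basis_exists :
  exists d, exists b : 'I_d -> V, quotient_basis P Q b.
Proof.
pose S d := `[< exists2 b : 'I_d -> V, forall i, P (b i) & row_free (mx b) >].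
have S0 : S 0%N.
  by apply/asboolP; exists (fun _ => 0) => //; rewrite /row_free -leqn0 rank_leq_row.
have Sm d : S d -> (d <= m)%N.
  by move=> /asboolP[b _ /eqP <-]; apply: rank_leq_col.
have exS : exists d, S d by exists 0%N.
have [d /asboolP[b Pb fr] dmax] := ex_maxnP exS Sm.
exists d, b; split=> //; last exact/row_free_image.
move=> f Pf; case: (boolP (phi f <= mx b)%MS) => [/submxP[c cE] | nf].
  exists (fun i => c 0 i); apply/QE.
    by rewrite -scaleN1r addrC; apply: P_submod => //; apply: lincomb_closed.
  rewrite linearB /= image_lincomb cE; apply/eqP; rewrite subr_eq0; apply/eqP.
  by congr mulmx; apply/rowP => j; rewrite mxE.
suff /dmax : S d.+1 by rewrite ltnn.
apply/asboolP; exists (fun i => oapp b f (unlift ord0 i)).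
  by move=> i; case: unlift => [j|] /=.
rewrite /row_free eqn_leq rank_leq_row /=.
have lt : (mx b < mx b + phi f)%MS.
  by rewrite ltmxE addsmxSl; apply: contra nf; apply: submx_trans (addsmxSr _ _).
have := rank_ltmx lt; rewrite (eqP fr) => /leq_trans; apply.
set B := (X in (\rank _ <= \rank X)%N); apply: mxrankS; rewrite addsmx_sub; apply/andP; split.
  apply/row_subP => i; rewrite rowK.
  have -> : phi (b i) = row (fintype.lift ord0 i) B by rewrite rowK fintype.liftK.
  exact: row_sub.
have -> : phi f = row ord0 B by rewrite rowK unlift_none.
exact: row_sub.
Qed.

Lemma quotient_dimP :
  exists b : 'I_(quotient_dim P Q) -> V, quotient_basis P Q b.
Proof. exact: (xgetPex 0%N quotient_basis_exists). Qed.

Lemma quotient_dim_le : (quotient_dim P Q <= m)%N.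
Proof.
have [b [Pb _ /(row_free_image Pb)/eqP <-]] := quotient_dimP.
exact: rank_leq_col.
Qed.

Lemma quotient_dim_ge (n : nat) (v : 'I_n -> V) : (forall i, P (v i)) ->
  (forall c : 'I_n -> F, Q (\sum_(i < n) c i *: v i) -> forall i, c i = 0) ->
  (n <= quotient_dim P Q)%N.
Proof.
move=> Pv fv; have [b bas] := quotient_dimP.
exact: (quotient_basis_max bas Pv (proj2 (row_free_image Pv) fv)).
Qed.

End QuotientDim.

(** * Evaluation of multilinear polynomials on a spanning family *)

Section PolyEval.

Variables (F : fieldType) (A : lmodType F) (mul : {bilinear A -> A -> A}).

Lemma poly_eval_is_linear (a : nat -> A) : linear (poly_eval mul a).
Proof.
move=> c u v; rewrite /poly_eval.
have add (x y : {freeg word / F}) : fglift (eval_word mul a) (x + y) =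
    fglift (eval_word mul a) x + fglift (eval_word mul a) y.
  have addB := lift_is_additive (eval_word mul a).
  have := addB (x + y) y; rewrite addrK => ->; by rewrite subrK.
have f0 : fglift (eval_word mul a) 0 = 0.
  by apply: (@addrI _ (fglift (eval_word mul a) 0)); rewrite -add !addr0.
rewrite add; congr (_ + _).
rewrite -[in RHS](freeg_sumE u) [c *: u]/(fgscale c u) /fgscale.
rewrite !(big_morph _ add f0) scaler_sumr; apply: eq_bigr => w _.
by rewrite !liftU scalerA.
Qed.

HB.instance Definition _ (a : nat -> A) :=
  GRing.isLinear.Build F {freeg word / F} A *:%R (poly_eval mul a)
    (poly_eval_is_linear a).

Lemma poly_evalE (a : nat -> A) (f : {freeg word / F}) :
  poly_eval mul a f = \sum_(w <- dom f) coeff w f *: eval_word mul a w.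
Proof.
rewrite -{1}[f]freeg_sumE linear_sum; apply: eq_bigr => w _.
by rewrite /= /poly_eval liftU.
Qed.

Lemma poly_eval_monomial (a : nat -> A) (w : word) :
  poly_eval mul a << w >> = eval_word mul a w.
Proof. by rewrite /poly_eval liftU scale1r. Qed.

Lemma multilinear_submod n (c : F) (u v : {freeg word / F}) :
  multilinear n u -> multilinear n v -> multilinear n (c *: u + v).
Proof.
move=> Pu Pv w /domD_subset; rewrite mem_cat => /orP[/domZ_subset|]; last exact: Pv.
exact: Pu.
Qed.

Lemma multilinear0 n : multilinear n (0 : {freeg word / F}).
Proof. by move=> w; rewrite dom0. Qed.

Lemma multilinear_monomial n w : perm_eq (letters w) (iota 0 n) ->
  multilinear n (<< w >> : {freeg word / F}).
Proof. by move=> ww v; rewrite domU1 inE => /eqP ->. Qed.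

Lemma eq_eval_word (a b : nat -> A) (w : word) :
  {in letters w, a =1 b} -> eval_word mul a w = eval_word mul b w.
Proof.
elim: w => [k|u IHu v IHv] /= ab; first by apply: ab; rewrite inE.
by rewrite IHu ?IHv // => k kw; apply: ab; rewrite mem_cat kw ?orbT.
Qed.

Definition upd (a : nat -> A) (k : nat) (x : A) : nat -> A :=
  fun i => if i == k then x else a i.

Lemma eval_word_upd_out (a : nat -> A) k x (w : word) : k \notin letters w ->
  eval_word mul (upd a k x) w = eval_word mul a w.
Proof.
move=> kw; apply: eq_eval_word => i iw; rewrite /upd.
by case: eqP iw kw => // -> ->.
Qed.

Lemma eval_word_upd_sum (a : nat -> A) k (w : word) (I : finType)
    (c : I -> F) (x : I -> A) : count_mem k (letters w) = 1%N ->
  eval_word mul (upd a k (\sum_i c i *: x i)) w =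
  \sum_i c i *: eval_word mul (upd a k (x i)) w.
Proof.
elim: w => [j|u IHu v IHv] /=.
  rewrite addn0 /upd; by case: eqP.
rewrite count_cat; case cu: (count_mem k (letters u)) => [|[|?]] //=.
  have ku : k \notin letters u by apply/count_memPn.
  rewrite add0n (eval_word_upd_out _ _ ku) => /IHv ->.
  rewrite linear_sumr; apply: eq_bigr => i _.
  by rewrite (eval_word_upd_out _ _ ku) linearZr_LR.
rewrite add1n => -[cv]; have kv : k \notin letters v by apply/count_memPn.
rewrite (IHu cu) linear_sumlz; apply: eq_bigr => i _.
by rewrite linearZl_LR /= !(eval_word_upd_out _ _ kv).
Qed.

(** Arguments are freed one at a time: by induction on [m] the first [m] variables take arbitrary
    values while the others up to x_n stay in the spanning family. *)
Lemma multilinear_identity (I : finType) (i0 : I) (e : I -> A) (n : nat)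
    (f : {freeg word / F}) :
  (forall x : A, exists c : I -> F, x = \sum_i c i *: e i) ->
  multilinear n f ->
  (forall g : nat -> I, poly_eval mul (e \o g) f = 0) ->
  identities mul f.
Proof.
move=> span Pf f0 a.
suff H m (a' : nat -> A) :
    (forall k, (m <= k < n)%N -> exists i, a' k = e i) -> poly_eval mul a' f = 0.
  by apply: (H n) => k; case: leqP.
elim: m a' => [|m IHm] a' ha'.
  have [g gE] : {g : nat -> I & forall k, (k < n)%N -> a' k = e (g k)}.
    apply: (@choice _ _ (fun k i => (k < n)%N -> a' k = e i)) => k.
    (* [i0] fills the variables beyond x_n, which do not occur in [f]. *)
    by case: (ltnP k n) => [/ha'[i ->]|]; [exists i|exists i0].
  rewrite -[RHS](f0 g) !poly_evalE big_seq [RHS]big_seq; apply: eq_bigr => w /Pf ww.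
  congr (_ *: _); apply: eq_eval_word => k.
  by rewrite (perm_mem ww) mem_iota => /gE.
have [nm|mn] := leqP n m; first 
  by apply: IHm => k /andP[mk kn]; have := leq_trans kn nm; rewrite ltnNge mk.
have [c cE] := span (a' m).
have -> : a' = upd a' m (\sum_i c i *: e i).
  by apply: funext => k; rewrite /upd -cE; case: eqP => // ->.
rewrite poly_evalE big_seq.
under eq_bigr => w /Pf ww.
  rewrite eval_word_upd_sum; last first.
    by rewrite (permP ww) count_uniq_mem ?iota_uniq // mem_iota mn.
  over.
rewrite -big_seq; under eq_bigr do rewrite scaler_sumr.
rewrite exchange_big /= big1 // => i _.
under eq_bigr do rewrite scalerA mulrC -scalerA.
rewrite -scaler_sumr -poly_evalE IHm ?scaler0 // => k /andP[mk kn].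
rewrite /upd; case: eqP => [_|/eqP nkm]; first by exists i.
by apply: ha'; rewrite kn andbT ltn_neqAle eq_sym nkm.
Qed.

End PolyEval.

(** * The grading of W and the upper bound by tuples of admissible degree *)

Section AlgebraW.

Variable F : fieldType.

Definition Wbasis (i : 'I_4) : 'rV[F]_4 := delta_mx 0 i.

(* e_{i-1} e_{j-1} is [e_{i+j-2}] if this holds and 0 otherwise. *)
Definition Wmul_nz (i j : nat) : bool :=
  [|| i == 1%N, j == 1%N | (i, j) \in [:: (0, 2); (0, 3); (2, 2)]%N].

Lemma Wmul_basis (i j : 'I_4) :
  Wmul (Wbasis i) (Wbasis j) =
  (Wmul_nz i j)%:R *: Wbasis (inord (i + j).-1).
Proof.
transitivity (We_mul F (i%:Z - 1) (j%:Z - 1)).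
  rewrite /Wmul (bigD1 i) //= (bigD1 j) //= !mxE !eqxx mul1r scale1r.
  rewrite big1 => [|k nk]; last by rewrite !mxE (negbTE nk) andbF mulr0 scale0r.
  rewrite big1 => [|k nk]; first by rewrite !addr0.
  by rewrite big1 // => l _; rewrite !mxE (negbTE nk) andbF mul0r scale0r.
rewrite /We_mul /We /Wbasis.
by case: i j => [[|[|[|[|//]]]] ?] [[|[|[|[|//]]]] ?] /=; rewrite ?scale1r ?scale0r.
Qed.

Lemma Wbasis_coord (i j : 'I_4) : Wbasis i 0 j = (i == j)%:R.
Proof. by rewrite mxE eqxx eq_sym. Qed.

Lemma Wbasis_sum (u : 'rV[F]_4) : u = \sum_i u 0 i *: Wbasis i.
Proof. exact: row_sum_delta. Qed.

Lemma Wmul_coord (u v : 'rV[F]_4) :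
  Wmul u v = \sum_i \sum_j (u 0 i * v 0 j) *: Wmul (Wbasis i) (Wbasis j).
Proof.
rewrite {1}[u]Wbasis_sum {1}[v]Wbasis_sum linear_sumlz; apply: eq_bigr => i _.
rewrite linear_sumr; apply: eq_bigr => j _.
by rewrite linearZl_LR linearZr_LR /= scalerA.
Qed.

(** W is graded and the index [k] has degree k - 1; this is additivity of degrees along [w], written
    without subtraction. *)
Lemma eval_word_degree (g : nat -> 'I_4) (w : word) (k : 'I_4) :
  eval_word (@Wmul F) (Wbasis \o g) w 0 k != 0 ->
  (k + size (letters w) = (\sum_(i <- letters w) g i).+1)%N.
Proof.
elim: w k => [x|u IHu v IHv] k /=.
  rewrite Wbasis_coord big_seq1; case: (g x =P k) => [->|]; last by rewrite eqxx.
  by rewrite addn1.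
move=> nz; suff [i [j [/IHu Du /IHv Dv kE]]] : exists i, exists j,
    [/\ eval_word (@Wmul F) (Wbasis \o g) u 0 i != 0,
        eval_word (@Wmul F) (Wbasis \o g) v 0 j != 0 & (k + 1 = i + j)%N].
  by rewrite size_cat big_cat /=; lia.
apply: contraPP (nz) => H; apply/negP/negPn; rewrite Wmul_coord summxE.
rewrite big1 // => i _; rewrite summxE big1 // => j _.
rewrite Wmul_basis scalerA mxE Wbasis_coord.
case: (altP (_ =P k)) => [kE|_]; last by rewrite mulr0.
case nzij: (Wmul_nz i j); last by rewrite mulr0 mul0r.
apply/eqP; rewrite !mulr1 mulf_eq0; apply: contraPT H; rewrite negb_or => /andP[iu jv].
apply; exists i, j; split=> //; rewrite -kE inordK.
  by move: nzij; case: i {iu kE} => [[|i] ?]; case: j {jv} => [[|j] ?] //= _; lia.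
by move: nzij; case: i {iu kE} => [[|[|[|[|]]]] ?]; case: j {jv} => [[|[|[|[|]]]] ?].
Qed.

(* The variables from x_{n+1} on go to e_2. *)
Definition assign n (e : {ffun 'I_n -> 'I_4}) (k : nat) : 'I_4 :=
  if insub k is Some i then e i else ord_max.

Lemma assign_ord n (e : {ffun 'I_n -> 'I_4}) (i : 'I_n) : assign e i = e i.
Proof. by rewrite /assign valK. Qed.

Lemma assign_out n (e : {ffun 'I_n -> 'I_4}) : assign e n = ord_max.
Proof. by rewrite /assign insubN // ltnn. Qed.

Lemma sum_assign n (e : {ffun 'I_n -> 'I_4}) :
  (\sum_(k <- iota 0 n) assign e k = \sum_i e i)%N.
Proof.
rewrite -[n in iota 0 n]subn0 -/(index_iota 0 n) big_mkord.
by apply: eq_bigr => i _; rewrite assign_ord.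
Qed.

(** The tuples whose total degree, the sum of the [e i - 1], lies in [-1, 2]. *)
Definition admissible n : {set {ffun 'I_n -> 'I_4}} :=
  [set e : {ffun 'I_n -> 'I_4} | (n <= (\sum_i e i).+1)%N && (\sum_i e i < n + 3)%N].

Lemma poly_eval_degree n (f : {freeg word / F}) (e : {ffun 'I_n -> 'I_4}) k :
  multilinear n f -> poly_eval (@Wmul F) (Wbasis \o assign e) f 0 k != 0 ->
  (k + n = (\sum_i e i).+1)%N.
Proof.
move=> Pf; rewrite poly_evalE summxE => nz; apply/eqP; apply: contraNT nz => nk.
rewrite big_seq big1 // => w /Pf ww; rewrite mxE; apply/eqP.
rewrite mulf_eq0; apply/orP; right; apply: contraNT nk => /eval_word_degree.
by rewrite (perm_size ww) size_iota (perm_big _ ww) /= sum_assign => ->.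
Qed.

Section EvalRow.

Variable n : nat.

(** One entry per tuple is enough: for multilinear [f], the grading leaves only the coordinate of
    the total degree. *)
Definition eval_row (f : {freeg word / F}) : 'rV[F]_#|admissible n| :=
  \row_i let e := enum_val i in
    poly_eval (@Wmul F) (Wbasis \o assign e) f 0 (inord ((\sum_i e i).+1 - n)).

Lemma eval_row_is_linear : linear eval_row.
Proof. by move=> c u v; apply/rowP => i; rewrite !mxE /= linearP !mxE. Qed.

HB.instance Definition _ :=
  GRing.isLinear.Build F {freeg word / F} 'rV[F]_#|admissible n| *:%R eval_row
    eval_row_is_linear.

Lemma eval_row_identities (f : {freeg word / F}) : multilinear n f ->
  ((multilinear n `&` identities (@Wmul F)) f <-> eval_row f = 0).
Proof.
move=> Pf; split=> [[_ idf]|f0]; first by apply/rowP => i; rewrite !mxE /= idf mxE.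
split=> //; apply: (multilinear_identity ord0 _ Pf (e := Wbasis)) => [x|g].
  by exists (x 0); apply: Wbasis_sum.
pose e := [ffun i : 'I_n => g i].
have -> : poly_eval (@Wmul F) (Wbasis \o g) f =
          poly_eval (@Wmul F) (Wbasis \o assign e) f.
  rewrite !poly_evalE big_seq [RHS]big_seq; apply: eq_bigr => w /Pf ww.
  congr (_ *: _); apply: eq_eval_word => k; rewrite (perm_mem ww) mem_iota /= => kn.
  by have := assign_ord e (Ordinal kn); rewrite /= => ->; rewrite ffunE.
apply/rowP => k; rewrite mxE; apply/eqP/negPn/negP => nz.
have kE := poly_eval_degree Pf nz.
(* A nonzero coordinate [k] forces total degree k - 1, so the tuple is recorded in [eval_row]. *)
have De : e \in admissible n by rewrite inE; move: (ltn_ord k) kE; lia.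
have := congr1 (fun r : 'rV_ _ => r 0 (enum_rank_in De e)) f0.
rewrite !mxE /= enum_rankK_in // (_ : inord _ = k) => [/eqP|]; first by rewrite (negPf nz).
by rewrite -kE addnK inord_val.
Qed.

Lemma codimW_le : (codim (@Wmul F) n <= #|admissible n|)%N.
Proof.
apply: (@quotient_dim_le _ _ _ _ _ eval_row).
- by move=> c u v; apply: multilinear_submod.
- exact: multilinear0.
- exact: eval_row_identities.
Qed.

Lemma codimW_ge m (v : 'I_m -> {freeg word / F}) :
  (forall i, multilinear n (v i)) ->
  (forall c : 'I_m -> F, identities (@Wmul F) (\sum_(i < m) c i *: v i) ->
     forall i, c i = 0) ->
  (m <= codim (@Wmul F) n)%N.
Proof.
move=> Pv fv; apply: (@quotient_dim_ge _ _ _ _ _ eval_row _ _ _ _ v) => //.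
- by move=> c x y; apply: multilinear_submod.
- exact: multilinear0.
- exact: eval_row_identities.
- by move=> c [_ /fv].
Qed.

End EvalRow.

(** * Monomials separating the tuples of degree 0, for the lower bound *)

Lemma Wmul_top_l (c : F) (u : 'rV[F]_4) :
  Wmul (c *: Wbasis ord_max) u = (c * u 0 1) *: Wbasis ord_max.
Proof.
rewrite linearZl_LR /= -scalerA; congr (_ *: _).
rewrite {1}[u]Wbasis_sum linear_sumr (bigD1 1) //= big1 ?addr0.
  rewrite linearZr_LR /= Wmul_basis /= scale1r; congr (_ *: Wbasis _).
  by apply/val_inj; rewrite /= inordK.
move=> i; rewrite linearZr_LR /= Wmul_basis => /negPf i1.
suff -> : Wmul_nz (@ord_max 3) i = false by rewrite scale0r scaler0.
by move: i1; case: i => [[|[|[|[|]]]] ?].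
Qed.

(* The variables in Z, O, M, T go to e_0, e_1, e_{-1}, e_2 respectively; in the
   coordinates of 'I_4 these are 1, 2, 0, 3. *)
Definition fits (Z O M T : seq nat) (g : nat -> 'I_4) :=
  [&& all (fun k => g k == 1) Z, all (fun k => val (g k) == 2%N) O,
      all (fun k => g k == 0) M & all (fun k => val (g k) == 3%N) T].

(* [w] separates the assignments that fit (Z, O, M, T) from all the other ones
   that have no more variables equal to the unit e_0. *)
Definition separates (v : nat) (Z O M T : seq nat) (w : word) :=
  forall g : nat -> 'I_4, g v = ord_max -> exists c : F,
  [/\ eval_word (@Wmul F) (Wbasis \o g) w = c *: Wbasis ord_max,
      fits Z O M T g -> c = 1
    & c != 0 -> all (fun k => g k == 1) Z /\
       (all (fun k => g k != 1) (O ++ M ++ T) -> fits Z O M T g)].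

(** As a right factor of e_2, the pair survives only at (e_0, e_0) and (e_{-1}, e_1); the first case
    costs extra units. *)
Lemma block_pair (i j : 'I_4) :
  Wmul (Wbasis i) (Wbasis j) 0 1 =
  ((i == 1) && (j == 1) || (i == 0) && (val j == 2%N))%:R.
Proof.
rewrite Wmul_basis mxE Wbasis_coord -natrM mulnb; congr (_%:R).
rewrite -!val_eqE /=.
by case: i j => [[|[|[|[|//]]]] ?] [[|[|[|[|//]]]] ?]; rewrite /= ?inordK.
Qed.

Lemma block_triple (i j k : 'I_4) :
  Wmul (Wbasis i) (Wmul (Wbasis j) (Wbasis k)) 0 1 =
  (let l := (j + k).-1 in Wmul_nz j k &&
   ((i == 1) && (l == 1%N) || (i == 0) && (l == 2%N)))%:R.
Proof.
rewrite Wmul_basis linearZr_LR mxE block_pair -natrM mulnb; congr (_%:R).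
rewrite -!val_eqE /=.
by case: i j k => [[|[|[|[|//]]]] ?] [[|[|[|[|//]]]] ?]
  [[|[|[|[|//]]]] ?]; rewrite /= ?inordK.
Qed.

(** The size condition supplies one e_{-1} for each e_1 and two for each e_2. The blocks for [Z],
    [T] and [O] are peeled off in turn, each contributing a scalar factor 0 or 1. *)
Lemma separating_word (v : nat) (Z O M T : seq nat) :
  (size M = size O + 2 * size T)%N ->
  exists2 w, perm_eq (letters w) (v :: Z ++ O ++ M ++ T) & separates v Z O M T w.
Proof.
elim: Z => [|z Z IHZ] sizeM; last first.
  have [w pw sw] := IHZ sizeM; exists (Mul w (Var z)).
    apply/permP => p; have := permP pw p; rewrite /= !count_cat /= ?count_cat /=; lia.
  move=> g gv; have [c [ec c1 c0]] := sw g gv.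
  exists (c * (g z == 1)%:R); split.
  - by rewrite /= ec Wmul_top_l Wbasis_coord.
  - rewrite /fits /= => /and3P[/andP[-> Zg] Og /andP[Mg Tg]].
    by rewrite mulr1 c1 // /fits Zg Og Mg.
  - rewrite mulf_eq0 negb_or => /andP[/c0[aZ H]].
    rewrite /fits /=; case: (g z =P 1) => [_ _|_]; last by rewrite eqxx.
    by split=> // /H.
elim: T M sizeM => [|t T IHT] M sizeM; last first.
  case: M sizeM => [|x [|y M]] sizeM; [by move: sizeM => /=; lia..|].
  have {}sizeM : size M = (size O + 2 * size T)%N by move: sizeM => /=; lia.
  have [w pw sw] := IHT M sizeM; exists (Mul w (Mul (Var x) (Mul (Var y) (Var t)))).
    apply/permP => p; have := permP pw p.
    by rewrite /= !count_cat /= ?count_cat /=; lia.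
  move=> g gv; have [c [ec c1 c0]] := sw g gv; eexists; split.
  - rewrite /= ec Wmul_top_l block_triple; reflexivity.
  - rewrite /fits /= => /and3P[Og /and3P[/eqP -> /eqP -> Mg] /andP[/eqP -> Tg]].
    by rewrite mulr1 c1 // /fits /= Og Mg.
  (* If none of [x], [y], [t] is a unit, a nonzero triple has outer factor e_{-1} and inner product
     e_1, which leaves only e_{-1} e_2 inside. *)
  rewrite mulf_eq0 negb_or => /andP[/c0[_ H]] nz; split=> //.
  rewrite all_cat /= all_cat /= => /andP[Og /and4P[x1 y1 Mg /andP[t1 Tg]]].
  have {}H : fits [::] O M T g by apply: H; rewrite !all_cat Og Mg.
  move: H nz x1 y1 t1; rewrite /fits /= => /and3P[-> -> ->]; rewrite -!val_eqE /=.
  by case: (g x) (g y) (g t) => [[|[|[|[|//]]]] ?] [[|[|[|[|//]]]] ?]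
    [[|[|[|[|//]]]] ?]; rewrite /= ?eqxx.
elim: O M sizeM => [|o O IHO] M sizeM; last first.
  case: M sizeM => [|x M] sizeM; first by move: sizeM => /=; lia.
  have {}sizeM : size M = (size O + 2 * size (Nil nat))%N by move: sizeM => /=; lia.
  have [w pw sw] := IHO M sizeM; exists (Mul w (Mul (Var x) (Var o))).
    apply/permP => p; have := permP pw p.
    by rewrite /= !count_cat /= ?count_cat /=; lia.
  move=> g gv; have [c [ec c1 c0]] := sw g gv; eexists; split.
  - rewrite /= ec Wmul_top_l block_pair; reflexivity.
  - rewrite /fits /= => /and3P[/andP[/eqP -> Og] /andP[/eqP -> Mg] _].
    by rewrite mulr1 c1 // /fits /= Og Mg.
  rewrite mulf_eq0 negb_or => /andP[/c0[_ H]] nz; split=> //.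
  rewrite /= all_cat /= cats0 => /andP[no1 /and3P[Og x1 Mg]].
  have {}H : fits [::] O M [::] g by apply: H; rewrite !all_cat Og Mg.
  move: H nz x1 no1; rewrite /fits /= => /and3P[-> -> _]; rewrite -!val_eqE /=.
  by case: (g x) (g o) => [[|[|[|[|//]]]] ?] [[|[|[|[|//]]]] ?]; rewrite /= ?eqxx.
case: M sizeM => // _; exists (Var v) => // g gv; exists 1; split=> //.
by rewrite /= gv scale1r.
Qed.

Definition level (g : nat -> 'I_4) (s : seq nat) (i : nat) : seq nat :=
  [seq k <- s | val (g k) == i].

Lemma perm_levels (g : nat -> 'I_4) (s : seq nat) :
  perm_eq (level g s 1 ++ level g s 2 ++ level g s 0 ++ level g s 3) s.
Proof.
apply/permP => p; rewrite !count_cat !count_filter; elim: s => //= k s <-.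
by case: (g k) => [[|[|[|[|//]]]] ?] /=; case: (p k) => /=; lia.
Qed.

Lemma size_levels (g : nat -> 'I_4) (s : seq nat) :
  (\sum_(k <- s) g k + size (level g s 0) =
   size s + (size (level g s 2) + 2 * size (level g s 3)))%N.
Proof.
rewrite !size_filter; elim: s => [|k s IHs]; first by rewrite big_nil.
rewrite big_cons /=; move: IHs; set S := (\sum_(_ <- _) _)%N.
by case: (g k) => [[|[|[|[|//]]]] ?] /=; lia.
Qed.

Definition units n (e : {ffun 'I_n -> 'I_4}) : {set 'I_n} :=
  [set i : 'I_n | e i == 1].

(** Degree 0 is the size condition of [separating_word] for the level sets of [e]. The extra
    variable, which [assign] sends to e_2, starts the monomial; the inclusions of unit sets express
    triangularity. *)
Lemma tuple_word n (e : {ffun 'I_n -> 'I_4}) : (\sum_i e i = n)%N ->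
  exists2 w, perm_eq (letters w) (iota 0 n.+1) &
  forall e' : {ffun 'I_n -> 'I_4}, exists c : F,
  [/\ eval_word (@Wmul F) (Wbasis \o assign e') w = c *: Wbasis ord_max,
      e' = e -> c = 1
    & c != 0 -> units e \subset units e' /\ (units e' \subset units e -> e' = e)].
Proof.
move=> se; pose s := iota 0 n; pose L := level (assign e) s.
have sizeM : (size (L 0) = size (L 2) + 2 * size (L 3))%N.
  by have := size_levels (assign e) s; rewrite sum_assign se size_iota => /addnI.
have [w pw sw] := separating_word n (L 1) sizeM; exists w.
  rewrite (permPl pw) -[n.+1]addn1 iotaD add0n cats1 (permPr (permEl (perm_rcons _ _))).
  by rewrite perm_cons perm_levels.
have mL i (k : 'I_n) : (val k \in L i) = (val (e k) == i).
  by rewrite mem_filter assign_ord mem_iota /= ltn_ord andbT.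
move=> e'; have [c [ec c1 c0]] := sw (assign e') (assign_out _).
have fitsE : fits (L 1) (L 2) (L 0) (L 3) (assign e') <-> e' = e.
  split=> [/and4P[/allP l1 /allP l2 /allP l0 /allP l3]|->].
    apply/ffunP => k; apply/val_inj.
    have := (l1 k, l2 k, l0 k, l3 k); rewrite !mL !assign_ord -!val_eqE /=.
    case: (e k) => [[|[|[|[|//]]]] ?] /= [[[]]].
    - by move=> _ _ /(_ isT)/eqP.
    - by move=> /(_ isT)/eqP.
    - by move=> _ /(_ isT)/eqP.
    - by move=> _ _ _ /(_ isT)/eqP.
  by apply/and4P; split; apply/allP => k; rewrite mem_filter => /andP[].
exists c; split=> // [/fitsE/c1 //|/c0[/allP aZ H]]; split.
  apply/fintype.subsetP => k; rewrite !inE => ek.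
  by have := aZ k; rewrite mL assign_ord (eqP ek) => /(_ isT).
move=> /fintype.subsetP sub; apply/fitsE/H/allP => k.
have [kn|nk] := ltnP k n; last first.
  by rewrite !mem_cat !mem_filter !mem_iota /= add0n ltnNge nk !andbF.
rewrite -[k]/(val (Ordinal kn)) !mem_cat !mL assign_ord => h.
apply/negP => e'1; have := sub (Ordinal kn); rewrite !inE e'1 => /(_ isT) e1.
by move: h; rewrite (eqP e1).
Qed.

Definition balanced n : {set {ffun 'I_n -> 'I_4}} :=
  [set e : {ffun 'I_n -> 'I_4} | (\sum_i e i == n)%N].

Lemma codimW_ge_balanced n : (#|balanced n| <= codim (@Wmul F) n.+1)%N.
Proof.
have wP (i : 'I_#|balanced n|) : exists w, perm_eq (letters w) (iota 0 n.+1) /\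
  forall e' : {ffun 'I_n -> 'I_4}, exists c : F,
  [/\ eval_word (@Wmul F) (Wbasis \o assign e') w = c *: Wbasis ord_max,
      e' = enum_val i -> c = 1
    & c != 0 -> units (enum_val i) \subset units e' /\
               (units e' \subset units (enum_val i) -> e' = enum_val i)].
  have := enum_valP i; rewrite inE => /eqP /tuple_word[w pw Hw].
  by exists w.
have [w {}wP] := choice wP.
apply: (codimW_ge (v := fun i => << w i >>)) => [i|c idc i].
  by apply: multilinear_monomial; case: (wP i).
apply/eqP/negPn/negP => ci.
(* Among the indices with nonzero coefficient choose one whose tuple has fewest units; evaluation
   there leaves only its own monomial. *)
pose size_units (i : 'I_#|balanced n|) := #|units (enum_val i)|.
have [j cj jmin] := @arg_minnP _ i (fun i => c i != 0) size_units ci.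
have := idc (Wbasis \o assign (enum_val j)).
rewrite linear_sum (bigD1 j) //= big1 => [|k nkj].
  rewrite linearZ /= poly_eval_monomial addr0.
  have [_ /(_ (enum_val j))[d [-> -> // _]]] := wP j.
  rewrite scale1r => /rowP/(_ ord_max)/eqP.
  by rewrite !mxE !eqxx mulr1 (negPf cj).
rewrite linearZ /= poly_eval_monomial.
have [_ /(_ (enum_val j))[d [-> _ H]]] := wP k.
have [->|ck] := eqVneq (c k) 0; first by rewrite scale0r.
have [->|/H[sub eqkj]] := eqVneq d 0; first by rewrite scale0r scaler0.
(* The units of tuple [k] lie among those of tuple [j]; by minimality the two sets agree, hence so
   do the tuples. *)
case/negP: nkj; apply/eqP/enum_val_inj; rewrite eqkj //.
have /eqP -> : units (enum_val k) == units (enum_val j) by rewrite eqEcard sub jmin.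
by [].
Qed.

End AlgebraW.

(** * Counting balanced tuples and estimating binomial coefficients *)

Lemma sum_mem_set (T : finType) (A : {set T}) : (\sum_i (i \in A) = #|A|)%N.
Proof. by rewrite -sum1_card [RHS]big_mkcond; apply: eq_bigr => i _; case: (i \in A). Qed.

(* A balanced tuple is [i |-> (i \in B.1) + 2 * (i \in B.2)] with
   #|B.1| + 2 * #|B.2| = n. *)
Lemma card_balanced_ge n j : (2 * j <= n)%N ->
  ('C(n, 2 * j) * 'C(n, j) <= #|balanced n|)%N.
Proof.
move=> jn; pose S k : {set {set 'I_n}} := [set B : {set 'I_n} | #|B| == k]%SET.
pose f (B : {set 'I_n} * {set 'I_n}) : {ffun 'I_n -> 'I_4} :=
  [ffun i => inord ((i \in B.1) + 2 * (i \in B.2))].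
have fE B i : val (f B i) = ((i \in B.1) + 2 * (i \in B.2))%N.
  by rewrite ffunE /= inordK //; do 2!case: (_ \in _).
have f_inj : injective f.
  move=> [A B] [A' B'] eqf; congr (_, _); apply/setP => i;
  by have := fE (A, B) i; rewrite eqf fE /=; do 4!case: (_ \in _).
have cS k : #|S k| = 'C(n, k) by rewrite card_draws card_ord.
(* [B.1] has n - 2j elements, hence the symmetry of binomials. *)
rewrite -bin_sub // -!cS -cardsX -(card_imset _ f_inj).
apply/subset_leq_card/fintype.subsetP => _ /imsetP[[A B] AB ->].
move: AB; rewrite !inE /= => /andP[/eqP cA /eqP cB].
under eq_bigr do rewrite fE /=.
by rewrite big_split /= -big_distrr /= !sum_mem_set cA cB; apply/eqP; lia.
Qed.

(** The sequence k^j / j! in j is largest at j = k: it grows as long as the next factor k / (j + 1)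
    is at least 1. *)
Lemma fact_exp_le k j : (k`! * k ^ j <= j`! * k ^ k)%N.
Proof.
have up a m : ((a + m)`! <= a`! * (a + m) ^ m)%N.
  elim: m => [|m IHm]; first by rewrite addn0 muln1.
  rewrite addnS factS expnS mulnCA leq_mul2l; apply/orP; right.
  apply: leq_trans IHm _; rewrite leq_mul2l; apply/orP; right.
  by case: m => // m; rewrite leq_exp2r.
have dn a m : (a`! * a ^ m <= (a + m)`!)%N.
  elim: m => [|m IHm]; first by rewrite addn0 muln1.
  by rewrite addnS factS expnS mulnCA leq_mul // leqW // leq_addr.
have [jk|kj] := leqP j k.
  have := up j (k - j)%N; rewrite subnKC // => /leq_trans le.
  have -> : (k ^ k = k ^ (k - j) * k ^ j)%N by rewrite -expnD subnK.
  by rewrite mulnA leq_mul2r le ?orbT.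
have := dn k (j - k)%N; rewrite (subnKC (ltnW kj)) => le.
have -> : (k ^ j = k ^ (j - k) * k ^ k)%N by rewrite -expnD subnK // ltnW.
by rewrite mulnA leq_mul2r le ?orbT.
Qed.

(* The term [i = k] is the largest one of the expansion of (k + (n - k))^n. *)
Lemma exp_le_bin n k : (k <= n)%N ->
  (n ^ n <= n.+1 * ('C(n, k) * (k ^ k * (n - k) ^ (n - k))))%N.
Proof.
move=> kn; rewrite -{1}(subnK kn) expnDn.
rewrite -[n.+1 in leqRHS]card_ord -sum_nat_const; apply: leq_sum => i _.
have ilen : (i <= n)%N by rewrite -ltnS.
(* Clearing these factorials splits the comparison into [fact_exp_le] for k against i and for n - k
   against n - i. *)
have pos : (0 < i`! * (n - i)`! * (k`! * (n - k)`!))%N by rewrite !muln_gt0 !fact_gt0.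
rewrite -(leq_pmul2l pos).
have bi := bin_fact ilen; have bk := bin_fact kn.
have -> : (i`! * (n - i)`! * (k`! * (n - k)`!) * ('C(n, i) * ((n - k) ^ (n - i) * k ^ i))
   = n`! * ((k`! * k ^ i) * ((n - k)`! * (n - k) ^ (n - i))))%N.
  by rewrite -bi; ring.
have -> : (i`! * (n - i)`! * (k`! * (n - k)`!) * ('C(n, k) * (k ^ k * (n - k) ^ (n - k)))
   = n`! * ((i`! * k ^ k) * ((n - i)`! * (n - k) ^ (n - k))))%N.
  by rewrite -bk; ring.
by rewrite leq_mul2l leq_mul ?orbT ?fact_exp_le.
Qed.

(** * Entropy and the limits used for the growth rate *)

Section Analysis.

Variable R : realType.
Implicit Types x : R.

Definition entropy x : R := - (x * ln x) - (1 - x) * ln (1 - x).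

Lemma ln_natX (k : nat) : ln (k%:R ^+ k : R) = k%:R * ln k%:R.
Proof.
by case: k => [|k]; [rewrite expr0 ln1 mul0r | rewrite lnXn // mulr_natl].
Qed.

Lemma natr_ln_div (k n : nat) : (0 < n)%N ->
  k%:R * ln (k%:R / n%:R : R) = k%:R * (ln k%:R - ln n%:R).
Proof.
case: k => [|k] n0; first by rewrite !mul0r.
by rewrite ln_div // posrE ltr0n.
Qed.

(** The logarithm of [exp_le_bin], whose factor n + 1 becomes the error term. *)
Lemma ln_bin_ge (n k : nat) : (k <= n)%N ->
  n%:R * entropy (k%:R / n%:R) - ln n.+1%:R <= ln ('C(n, k)%:R : R).
Proof.
case: n => [|n] kn.
  by move: kn; rewrite leqn0 => /eqP ->; rewrite mul0r bin0 ln1 subrr.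
have : ((n.+1 ^ n.+1)%:R : R) <=
       (n.+2 * ('C(n.+1, k) * (k ^ k * (n.+1 - k) ^ (n.+1 - k))))%:R.
  by rewrite ler_nat exp_le_bin.
have pos (m : nat) : (m%:R ^+ m : R) \is Num.pos.
  by case: m => [|m]; rewrite posrE ?expr0 // exprn_gt0.
have Cpos : ('C(n.+1, k)%:R : R) \is Num.pos by rewrite posrE ltr0n bin_gt0.
rewrite !natrM !natrX -ler_ln ?rpredM ?pos //; try by rewrite posrE.
rewrite !lnM ?rpredM ?pos //; try by rewrite posrE.
rewrite !ln_natX.
suff -> : n.+1%:R * entropy (k%:R / n.+1%:R) =
  n.+1%:R * ln n.+1%:R - k%:R * ln k%:R - (n.+1 - k)%:R * ln (n.+1 - k)%:R :> R by lra.
rewrite /entropy.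
have -> : 1 - k%:R / n.+1%:R = (n.+1 - k)%:R / n.+1%:R :> R.
  by rewrite natrB // mulrBl divff ?pnatr_eq0.
have nx (x y : R) : n.+1%:R * (x / n.+1%:R * y) = x * y.
  by rewrite mulrA [_ * (x / _)]mulrC divfK ?pnatr_eq0.
by rewrite mulrBr mulrN !nx !natr_ln_div // natrB //; ring.
Qed.

Lemma cvg_entropy (v : R^nat) x : 0 < x < 1 -> v @ \oo --> x ->
  entropy (v n) @[n --> \oo] --> entropy x.
Proof.
move=> /andP[x0 x1] vx; have vx1 : 1 - v n @[n --> \oo] --> 1 - x.
  by apply: cvgB => //; exact: cvg_cst.
apply: cvgB; [apply: cvgN|]; apply: cvgM => //.
  by apply: (continuous_cvg _ (continuous_ln x0)).
by apply: (continuous_cvg _ (continuous_ln _)) => //; rewrite subr_gt0.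
Qed.

(** With s = sqrt (n + 1), ln (s^2) = 2 ln s <= 2 s, so the quotient is at most 2 / s. *)
Lemma cvg_ln_harmonic : (ln n.+1%:R / n.+1%:R : R) @[n --> \oo] --> (0 : R).
Proof.
have sq0 : 2 * Num.sqrt (harmonic n : R) @[n --> \oo] --> (0 : R).
  suff : 2 * Num.sqrt (harmonic n : R) @[n --> \oo] --> 2 * Num.sqrt (0 : R).
    by rewrite sqrtr0 mulr0.
  apply: cvgM; first exact: cvg_cst.
  by apply: (continuous_cvg _ (@sqrt_continuous R 0)); exact: cvg_harmonic.
apply: squeeze_cvgr (cvg_cst 0) sq0; near=> n.
have n0 : 0 < n.+1%:R :> R by [].
rewrite divr_ge0 ?ln_ge0 ?ler1n //= ler_pdivrMr //.
pose s : R := Num.sqrt n.+1%:R; have s0 : 0 < s by rewrite sqrtr_gt0.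
have nE : n.+1%:R = s ^+ 2 :> R by rewrite sqr_sqrtr ?ltW.
have -> : Num.sqrt (harmonic n) = s^-1 :> R by rewrite -sqrtrV ?ltW.
rewrite nE lnXn //; have := ln_sublinear s0.
have -> : 2 / s * s ^+ 2 = 2 * s by field; rewrite gt_eqF.
by rewrite -mulr_natl => h; lra.
Unshelve. all: by end_near. Qed.

Lemma cvg_truncn_div (a : R) : 0 <= a ->
  ((Num.truncn (a * n%:R))%:R / n%:R : R) @[n --> \oo] --> a.
Proof.
move=> a0; have cn : (n%:R^-1 : R) @[n --> \oo] --> (0 : R).
  by rewrite -cvg_shiftS; exact: cvg_harmonic.
have c1 : a - (n%:R^-1 : R) @[n --> \oo] --> a.
  rewrite -[X in _ --> X](subr0 a); apply: cvgB => //; exact: cvg_cst.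
apply: squeeze_cvgr c1 (cvg_cst a); near=> n.
have n0 : 0 < n%:R :> R by rewrite ltr0n; near: n; exact: nbhs_infty_gt.
have /andP[lo hi] := truncn_itv (mulr_ge0 a0 (ltW n0)).
rewrite ler_pdivrMr // lo andbT ler_pdivlMr // mulrBl mulVf ?gt_eqF //.
by move: hi; rewrite -natr1; lra.
Unshelve. all: by end_near. Qed.

End Analysis.

(** * The maximum of [Phi] on T *)

Lemma sum_ord4 (V : zmodType) (f : 'I_4 -> V) : \sum_k f k = f 0 + f 1 + f 2 + f 3.
Proof.
rewrite !big_ord_recl big_ord0 addr0 !addrA.
by congr (_ + _ + _ + _); congr f; apply/val_inj.
Qed.

(** This is the mean degree; its vanishing is the condition x_1 - x_3 = 2 x_4. *)
Lemma mean_ord4 (V : comNzRingType) (f : 'I_4 -> V) :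
  \sum_(k < 4) (k%:R - 1) * f k = f 2 + 2 * f 3 - f 0.
Proof.
rewrite sum_ord4 (_ : nat_of_ord (0 : 'I_4) = 0%N) // (_ : nat_of_ord (1 : 'I_4) = 1%N) //.
rewrite (_ : nat_of_ord (2 : 'I_4) = 2%N) // (_ : nat_of_ord (3 : 'I_4) = 3%N) //.
by ring.
Qed.

Section GrowthRate.

Variables (R : realType) (u : R).
Hypotheses (u0 : 0 < u) (u1 : u < 1) (u3 : 2 * u ^+ 3 + u ^+ 2 = 1).

(** The number Z with 1/u eliminated by the cubic, a polynomial form suited to the numerical
    estimate. *)
Definition rate : R := 1 + 2 * u + 3 * u ^+ 2.

Lemma rateE : rate = u^-1 + 1 + u + u ^+ 2.
Proof.
have -> : u^-1 = u + 2 * u ^+ 2.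
  transitivity ((2 * u ^+ 3 + u ^+ 2) / u); first by rewrite u3 mul1r.
  by field; rewrite gt_eqF.
by rewrite /rate; ring.
Qed.

Lemma rate_gt0 : 0 < rate.
Proof. by rewrite /rate; nra. Qed.

Definition weight (k : 'I_4) : R := u ^+ k / (u * rate).

Lemma weight_gt0 k : 0 < weight k.
Proof. by rewrite divr_gt0 ?exprn_gt0 ?mulr_gt0 ?rate_gt0. Qed.

Lemma ln_weight k : ln (weight k) = (k%:R - 1) * ln u - ln rate.
Proof.
have r0 := rate_gt0.
rewrite /weight ln_div ?posrE ?exprn_gt0 ?mulr_gt0 // lnXn // lnM ?posrE //.
by rewrite -mulr_natl; ring.
Qed.

Lemma sum_weight : \sum_k weight k = 1.
Proof.
rewrite -mulr_suml !big_ord_recl big_ord0 /= expr0 expr1 /bump /=.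
rewrite rateE; have : u != 0 by rewrite gt_eqF.
have := gt_eqF rate_gt0; rewrite rateE => h u_n0.
have e : u * (u^-1 + 1 + u + u ^+ 2) = 1 + (u + (u ^+ 2 + (u ^+ 3 + 0))) by field.
by rewrite -e mulfV // mulf_eq0 h orbF.
Qed.

Lemma weight_mean : \sum_(k < 4) (k%:R - 1) * weight k = 0.
Proof.
transitivity ((2 * u ^+ 3 + u ^+ 2 - 1) / (u * rate)).
  rewrite !big_ord_recl big_ord0 /weight /= /bump /=; field.
  by rewrite !gt_eqF // rate_gt0.
by rewrite u3 subrr mul0r.
Qed.

Lemma PhiE (x : 'rV[R]_4) : Phi x = expR (- \sum_k x 0 k * ln (x 0 k)).
Proof.
rewrite /Phi expRN; congr (_^-1).
rewrite (big_morph _ (@expRD R) (@expR0 R)); apply: eq_bigr => k _.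
by rewrite /powR; case: eqP => // ->; rewrite mul0r expR0.
Qed.

(** [ln (weight k)] is affine in the degree k - 1, so its average depends only on the total mass and
    the mean degree. *)
Lemma sum_ln_weight (x : 'I_4 -> R) :
  \sum_k x k = 1 -> \sum_(k < 4) (k%:R - 1) * x k = 0 ->
  \sum_k x k * ln (weight k) = - ln rate.
Proof.
move=> x1 x0; under eq_bigr do rewrite ln_weight mulrBr mulrA [x _ * (_ - 1)]mulrC.
by rewrite sumrB -!mulr_suml x0 x1 mul0r mul1r sub0r.
Qed.

Lemma Phi_weight : Phi (\row_k weight k) = rate.
Proof.
rewrite PhiE; under eq_bigr do rewrite !mxE.
by rewrite (sum_ln_weight sum_weight weight_mean) opprK lnK // posrE rate_gt0.
Qed.

Lemma weight_domT : @domT R (\row_k weight k).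
Proof.
have ur : 0 < u * rate by rewrite mulr_gt0 ?rate_gt0.
have dec k l : (l <= k)%N -> u ^+ k / (u * rate) <= u ^+ l / (u * rate).
  by move=> lk; rewrite ler_pM2r ?invr_gt0 // ler_wiXn2l // ltW.
have sw := sum_weight; have mw := weight_mean.
split.
- move=> i; rewrite mxE ltW ?weight_gt0 //= -sw (bigD1 i) //= lerDl.
  by apply: sumr_ge0 => k _; rewrite ltW ?weight_gt0.
- by split; rewrite !mxE; apply: dec.
- by rewrite !mxE -sum_ord4.
- by rewrite !mxE; move: mw; rewrite mean_ord4; lra.
Qed.

(** Gibbs' inequality: ln t <= t - 1 at the ratio of the weight to the coordinate, summed over the
    four terms; both families have mass 1. *)
Lemma Phi_le_rate (x : 'rV[R]_4) : @domT R x -> Phi x <= rate.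
Proof.
move=> [x01 _ sx mx].
have sumx : \sum_k x 0 k = 1.
  by rewrite sum_ord4.
have meanx : \sum_(k < 4) (k%:R - 1) * x 0 k = 0.
  by rewrite mean_ord4; move: mx; lra.
have r0 := rate_gt0.
rewrite PhiE -[leRHS]lnK ?posrE // ler_expR -[leRHS]opprK lerN2.
rewrite -(sum_ln_weight sumx meanx) -subr_ge0.
have sum0 : \sum_k (x 0 k - weight k) = 0 by rewrite sumrB sumx sum_weight subrr.
rewrite -sumrB -[leLHS]sum0; apply: ler_sum => k _.
have w0 := weight_gt0 k; have /andP[xk0 _] := x01 k.
have [->|xk] := eqVneq (x 0 k) 0; first by rewrite !mul0r subrr sub0r oppr_le0 ltW.
have {xk} xk : 0 < x 0 k by rewrite lt_neqAle eq_sym xk.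
have : ln (weight k / x 0 k) <= weight k / x 0 k - 1.
  have := @le_ln1Dx R (weight k / x 0 k - 1); rewrite [1 + _]addrC subrK; apply.
  by rewrite ltrBDl subrr divr_gt0.
rewrite ln_div ?posrE // => /(ler_wpM2l (ltW xk)); rewrite !mulrBr mulr1.
by rewrite mulrCA divff ?gt_eqF // mulr1; lra.
Qed.

(** * Bounds on the codimensions and the limit of their roots *)

Lemma codimW_upper (F : fieldType) n :
  (codim (@Wmul F) n)%:R <= rate ^+ n * u ^- 2.
Proof.
rewrite ler_pdivlMr ?exprn_gt0 //.
have -> : rate ^+ n = (\sum_(k < 4) u ^+ k) ^+ n / u ^+ n.
  rewrite -expr_div_n; congr (_ ^+ _).
  rewrite rateE !big_ord_recl big_ord0 /= expr0 expr1 /bump /=.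
  by field; rewrite gt_eqF.
rewrite ler_pdivlMr ?exprn_gt0 // -mulrA -exprD.
rewrite -[n in X in _ <= X](card_ord n) -prodr_const bigA_distr_bigA /=.
(* In the expansion of (1 + u + u^2 + u^3)^n over all tuples, an admissible one has exponent at most
   n + 2, hence a term of at least u^(n + 2). *)
apply: (@le_trans _ _ (\sum_(e in admissible n) u ^+ (2 + n))).
  rewrite sumr_const -[X in _ <= X]mulr_natl ler_pM2r ?exprn_gt0 //.
  by rewrite ler_nat codimW_le.
rewrite [leLHS]big_mkcond; apply: ler_sum => e _; rewrite prodrXr.
case: ifP => [|_]; last by rewrite exprn_ge0 ?ltW.
rewrite inE => /andP[_ h]; apply: ler_wiXn2l; [exact: ltW|exact: ltW|].
by rewrite (addnC 2) -ltnS -addnS.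
Qed.

(** As 1 + u + u^2 + u^3 = (1 + u)(1 + u^2), the two binary digits of an index are independent under
    [weight], with odds u and u^2. The digit worth 2 has probability [a], and by the cubic the digit
    worth 1 has probability 1 - 2a = u / (1 + u). *)
Let a : R := u ^+ 2 / (1 + u ^+ 2).

Let u2_gt0 : 0 < 1 + u ^+ 2. Proof. by rewrite addr_gt0 ?exprn_gt0. Qed.

Let a_gt0 : 0 < a. Proof. by rewrite divr_gt0 ?exprn_gt0. Qed.

Lemma double_a : 2 * a = 1 / (1 + u).
Proof.
have e : 2 * u ^+ 2 * (1 + u) = 1 + u ^+ 2.
  have -> : 2 * u ^+ 2 * (1 + u) = u ^+ 2 + (2 * u ^+ 3 + u ^+ 2) by ring.
  by rewrite u3 addrC.
by rewrite /a -e; field; rewrite !gt_eqF ?addr_gt0.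
Qed.

Lemma double_a_lt1 : 2 * a < 1.
Proof. by rewrite double_a ltr_pdivrMr ?mul1r ?ltrDl ?addr_gt0. Qed.

(** Entropy adds up over the two independent digits, so the sum is the entropy of [weight]. *)
Lemma entropy_a : entropy a + entropy (2 * a) = ln rate.
Proof.
have u1_gt0 : 0 < 1 + u by rewrite addr_gt0.
have lna : ln a = 2 * ln u - ln (1 + u ^+ 2).
  by rewrite ln_div ?posrE ?exprn_gt0 // lnXn // mulr_natl.
have lnCa : ln (1 - a) = - ln (1 + u ^+ 2).
  by rewrite -lnV ?posrE //; congr ln; rewrite /a; field; rewrite gt_eqF.
have ln2a : ln (2 * a) = - ln (1 + u) by rewrite double_a div1r lnV ?posrE.
have lnC2a : ln (1 - 2 * a) = ln u - ln (1 + u).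
  rewrite -ln_div ?posrE //; congr ln; rewrite double_a.
  by field; rewrite gt_eqF.
have -> : rate = (1 + u) * (1 + u ^+ 2) / u by rewrite rateE; field; rewrite gt_eqF.
rewrite ln_div ?posrE ?mulr_gt0 // lnM ?posrE //.
by rewrite /entropy lna lnCa ln2a lnC2a; ring.
Qed.

Definition sample n : nat := Num.truncn (a * n%:R).

(** Each of the two binomials contributes one error ln (n + 1). Positivity is recorded because the
    root is later written as [expR] of a logarithm. *)
Lemma codimW_lower (F : fieldType) n :
  let x : R := (sample n)%:R / n%:R in let c := codim (@Wmul F) n.+1 in
  (0 < c)%N /\
  n%:R * (entropy x + entropy (2 * x)) - 2 * ln n.+1%:R <= ln c%:R.
Proof.
move=> x c; set j := sample n in x *.
have /andP[jle _] := truncn_itv (mulr_ge0 (ltW a_gt0) (ler0n R n)).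
have j2 : (2 * j <= n)%N.
  rewrite -(ler_nat R) natrM; have := double_a_lt1; have := ler0n R n.
  by move: jle; rewrite -/(sample n) -/j; nra.
have jn : (j <= n)%N by lia.
have ge : ('C(n, 2 * j) * 'C(n, j) <= codim (@Wmul F) n.+1)%N.
  exact: leq_trans (card_balanced_ge j2) (codimW_ge_balanced F n).
have Cpos : (0 < 'C(n, 2 * j) * 'C(n, j))%N by rewrite muln_gt0 !bin_gt0 j2.
split; first exact: leq_trans Cpos ge.
apply: (@le_trans _ _ (ln ('C(n, 2 * j) * 'C(n, j))%:R)); last first.
  by rewrite ler_ln ?posrE ?ltr0n ?ler_nat // (leq_trans Cpos ge).
rewrite natrM lnM ?posrE ?ltr0n ?bin_gt0 //.
have := ln_bin_ge R j2; have := ln_bin_ge R jn; rewrite natrM -mulrA; lra.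
Qed.

Lemma cvg_codim_root (F : fieldType) : codim_root (@Wmul F) R @ \oo --> rate.
Proof.
have r0 := rate_gt0; rewrite -cvg_shiftS.
(* [lo] and [hi] enclose ln c_{n+1} / (n + 1); the factor n / (n + 1) arises because tuples of
   length n bound c_{n+1}. *)
pose lo n : R := n%:R / n.+1%:R *
   (entropy ((sample n)%:R / n%:R) + entropy (2 * ((sample n)%:R / n%:R))) -
   2 * (ln n.+1%:R / n.+1%:R).
pose hi n : R := ln rate - 2 * ln u * harmonic n.
have clo : lo n @[n --> \oo] --> ln rate.
  have cj : ((sample n)%:R / n%:R : R) @[n --> \oo] --> a := cvg_truncn_div (ltW a_gt0).
  suff : lo n @[n --> \oo] --> (1 - 0) * (entropy a + entropy (2 * a)) - 2 * (0 : R).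
    by rewrite entropy_a subr0 mul1r mulr0 subr0.
  apply: cvgB; last by apply: cvgM; [exact: cvg_cst | exact: cvg_ln_harmonic].
  apply: cvgM.
    have -> : (fun n => n%:R / n.+1%:R : R) = (fun n => 1 - harmonic n).
      by apply: funext => n; rewrite /harmonic /= -natr1; field; rewrite natr1 pnatr_eq0.
    by apply: cvgB; [exact: cvg_cst | exact: cvg_harmonic].
  apply: cvgD.
    by apply: cvg_entropy => //; rewrite a_gt0 /=; have := double_a_lt1; have := a_gt0; lra.
  apply: (cvg_entropy (v := fun n => 2 * ((sample n)%:R / n%:R))).
    by rewrite double_a_lt1 mulr_gt0.
  by apply: cvgM => //; exact: cvg_cst.
have chi : hi n @[n --> \oo] --> ln rate.
  suff : hi n @[n --> \oo] --> ln rate - 2 * ln u * 0 by rewrite mulr0 subr0.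
  apply: cvgB; first exact: cvg_cst.
  by apply: cvgM; [exact: cvg_cst | exact: cvg_harmonic].
have expc (v : R^nat) : v n @[n --> \oo] --> ln rate -> expR (v n) @[n --> \oo] --> rate.
  by move=> cv; rewrite -[rate]lnK ?posrE //; apply: (continuous_cvg _ (@continuous_expR R _)).
apply: squeeze_cvgr (expc _ clo) (expc _ chi); near=> n.
have n0 : 0 < n.+1%:R :> R by [].
have [cpos lower] := codimW_lower F n.
pose c : R := (codim (@Wmul F) n.+1)%:R.
have cpos' : 0 < c by rewrite ltr0n.
rewrite /= /codim_root /powR gt_eqF // !ler_expR; apply/andP; split.
  rewrite [leRHS]mulrC ler_pdivlMr //; apply: le_trans lower.
  by rewrite /lo le_eqVlt; apply/orP; left; apply/eqP; field; rewrite nat1r pnatr_eq0.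
have upper : ln c <= ln (rate ^+ n.+1 / u ^+ 2).
  by rewrite ler_ln ?codimW_upper // posrE // divr_gt0 // exprn_gt0.
move: upper; rewrite ln_div ?posrE ?exprn_gt0 // !lnXn // => upper.
apply: le_trans (ler_wpM2l _ upper) _ => //; rewrite /hi /harmonic /=.
rewrite mulrBr -[ln rate *+ _]mulr_natl -[ln u *+ _]mulr_natl.
rewrite mulrA mulVf ?pnatr_eq0 // mul1r.
by rewrite [_ * (2 * _)]mulrC.
Unshelve. all: by end_near. Qed.

End GrowthRate.

(** * Numerical location of the root, and the theorem *)

Lemma exists_root (R : realType) : exists u : R,
  [/\ 657 / 10 ^+ 3 + 298 / 10 ^+ 6 + 106 / 10 ^+ 9 + 13 / 10 ^+ 11 <= u,
      u <= 657 / 10 ^+ 3 + 298 / 10 ^+ 6 + 106 / 10 ^+ 9 + 14 / 10 ^+ 11 &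
      2 * u ^+ 3 + u ^+ 2 = 1].
Proof.
(* The bracket has width 10^-11; [rate] has slope 2 + 6u < 6 there, so it varies by less than 6 *
   10^-11, well within the tolerance 10^-9. *)
pose a : R := 657 / 10 ^+ 3 + 298 / 10 ^+ 6 + 106 / 10 ^+ 9 + 13 / 10 ^+ 11.
pose b : R := 657 / 10 ^+ 3 + 298 / 10 ^+ 6 + 106 / 10 ^+ 9 + 14 / 10 ^+ 11.
have ab : a <= b by rewrite /a /b; lra.
pose p : {poly R} := 2%:P * 'X ^+ 3 + 'X ^+ 2.
have pE x : p.[x] = 2 * x ^+ 3 + x ^+ 2 by rewrite /p !hornerE.
have [|u] := @IVT R (fun x => p.[x]) a b 1 ab (continuous_subspaceT (@continuous_horner _ p)).
  by rewrite ge_min le_max !pE /a /b; apply/andP; split; apply/orP; [left|right]; lra.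
by rewrite in_itv /= pE => /andP[au ub] pu; exists u.
Qed.

Theorem mainTheorem1 (R : realType) (F : fieldType)
    (char0 : [pchar F] =i pred0) :
  let expW : R := PI_exponent (@Wmul F) R in
  [/\ codim_root (@Wmul F) R @ \oo --> expW,
      ([set Phi x | x in @domT R] expW /\ ubound [set Phi x | x in @domT R] expW)
    & `|expW - (3 + 610 / 10 ^+ 3 + 718 / 10 ^+ 6 + 614 / 10 ^+ 9)|
        < 1 / 10 ^+ 9].
Proof.
have [u [lo hi u3]] := exists_root R.
have u0 : 0 < u by apply: lt_le_trans lo; lra.
have u1 : u < 1 by apply: le_lt_trans hi _; lra.
have cvg := cvg_codim_root u0 u1 u3 F.
have -> : PI_exponent (@Wmul F) R = rate u by apply: cvg_lim.
split=> //; first split.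
- by exists (\row_k weight u k); [exact: weight_domT | exact: Phi_weight].
- by move=> _ [x Tx <-]; exact: Phi_le_rate.
rewrite ltr_distl /rate; apply/andP; split; nra.
Qed.
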